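(* Let $m,n$ be integers with $0<m\leq |n|$ and $\gcd(m,n)=1$. Let $p$ denote the largest integer such that $2^p \mid 2m+2$. Then the $R_\infty$-nilpotency degree $r$ of $BS(m,n)$ is given by: (i) if $n<-1$, then $r=2$; (ii) if $n=-1$ (so $m=1$), then $r=\infty$; (iii) if $n=m$ (so $n=m=1$), then $r=\infty$; (iv) if $n-m=1$, then $r=\infty$; (v) if $n-m=2$, then $r=p+2$; (vi) if $n-m\geq 3$, then $r=2$.
   Context: For integers $m,n$, the Baumslag--Solitar group is $BS(m,n)=\langle a,b \mid a^{-1}b^m a=b^n\rangle$. For an endomorphism $\varphi$ of a group $G$, define the equivalence relation $x\sim y \Leftrightarrow \exists z\in G:\ x=z\,y\,\varphi(z)^{-1}$; the number of equivalence classes (possibly infinite) is denoted $R(\varphi)$. A group $G$ has the $R_\infty$-property if $R(\varphi)$ is infinite for every automorphism $\varphi$ of $G$. The lower central series of $G$ is $\gamma_1(G)=G$, $\gamma_{i+1}(G)=[G,\gamma_i(G)]$. The $R_\infty$-nilpotency degree of $G$ is the least positive integer $c$ such that $G/\gamma_{c+1}(G)$ has the $R_\infty$-property; if no such integer exists, the $R_\infty$-nilpotency degree is $\infty$. *)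

(* Defs.v *)
From HB Require Import structures.
From mathcomp Require Import all_boot all_order all_algebra.
From mathcomp Require Import all_classical.

Set Implicit Arguments.
Unset Strict Implicit.
Unset Printing Implicit Defensive.

Import Order.TTheory GRing.Theory Num.Theory.
Local Open Scope classical_set_scope.
Local Open Scope quotient_scope.
Local Open Scope group_scope.

Definition is_subgroup (G : groupType) (H : set G) : Prop :=
  [/\ H 1, forall x y, H x -> H y -> H (x * y) & forall x, H x -> H x^-1].

Definition is_normal_subgroup (G : groupType) (H : set G) : Prop :=
  is_subgroup H /\ forall x y, H x -> H (x ^ y).

Definition generated (G : groupType) (A : set G) : set G :=
  smallest (@is_subgroup G) A.

Definition normal_closure (G : groupType) (A : set G) : set G :=
  smallest (@is_normal_subgroup G) A.

Lemma generated_subgroup (G : groupType) (A : set G) :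
  is_subgroup (generated A).
Proof.
split=> [H [[]] // | x y Ax Ay H HA | x Ax H HA].
- by case: (HA) => [[_ HM _] _]; apply: HM; [apply: Ax | apply: Ay].
- by case: (HA) => [[_ _ HV] _]; apply: HV; apply: Ax.
Qed.

Lemma normal_closure_normal (G : groupType) (A : set G) :
  is_normal_subgroup (normal_closure A).
Proof.
split; first split=> [H [[[]]] // | x y Ax Ay H HA | x Ax H HA].
- by case: (HA) => [[[_ HM _] _] _]; apply: HM; [apply: Ax | apply: Ay].
- by case: (HA) => [[[_ _ HV] _] _]; apply: HV; apply: Ax.
- by move=> x y Ax H HA; case: (HA) => [[_ HJ] _]; apply: HJ; apply: Ax.
Qed.

Section QuotientGroup.
Variables (G : groupType) (N : set G) (nN : is_normal_subgroup N).

Definition coset_eq (x y : G) : bool := `[< N (x^-1 * y) >].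

Lemma coset_eq_refl : reflexive coset_eq.
Proof. by move=> x; apply/asboolP; rewrite mulVg; case: nN => [[]]. Qed.

Lemma coset_eq_sym : symmetric coset_eq.
Proof.
have NV := let: conj (And3 _ _ NV) _ := nN in NV.
by move=> x y; apply/asboolP/asboolP => /NV; rewrite invgM invgK.
Qed.

Lemma coset_eq_trans : transitive coset_eq.
Proof.
have NM := let: conj (And3 _ NM _) _ := nN in NM.
move=> y x z /asboolP Nxy /asboolP /(NM _ _ Nxy) Nxz; apply/asboolP.
by rewrite -mulgA mulVKg in Nxz.
Qed.

Canonical coset_equiv :=
  EquivRel coset_eq coset_eq_refl coset_eq_sym coset_eq_trans.

Definition quotient_group : Type := {eq_quot coset_equiv}.

HB.instance Definition _ := Choice.on quotient_group.
HB.instance Definition _ := Quotient.on quotient_group.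

Definition coset (x : G) : quotient_group := \pi x.

Lemma cosetP (x y : G) : coset x = coset y <-> N (x^-1 * y).
Proof.
split=> [/eqquotP/asboolP // | Nxy]; apply/eqquotP; exact/asboolP.
Qed.

Lemma coset_repr (u : quotient_group) : coset (repr u) = u.
Proof. exact: reprK. Qed.

Definition quotient_one : quotient_group := coset 1.
Definition quotient_mul (u v : quotient_group) := coset (repr u * repr v).
Definition quotient_inv (u : quotient_group) := coset (repr u)^-1.

Lemma coset_mul x y : quotient_mul (coset x) (coset y) = coset (x * y).
Proof.
have [[N1 NM NV] NJ] := nN.
apply/cosetP; set x' := repr _; set y' := repr _.
have /cosetP Nx : coset x' = coset x by apply: coset_repr.
have /cosetP Ny : coset y' = coset y by apply: coset_repr.
have -> : (x' * y')^-1 * (x * y) = (x'^-1 * x) ^ y' * (y'^-1 * y).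
  by rewrite conjgE invgM !mulgA mulgK.
by apply: NM => //; apply: NJ.
Qed.

Lemma coset_inv x : quotient_inv (coset x) = coset x^-1.
Proof.
have [[N1 NM NV] NJ] := nN.
apply/cosetP; set x' := repr _.
have /cosetP/NV : coset x' = coset x by apply: coset_repr.
rewrite invgM !invgK => Nx; have := NJ _ x^-1 Nx.
by rewrite conjgE invgK !mulgA mulgV mul1g.
Qed.

Lemma quotient_mulA : associative quotient_mul.
Proof.
move=> u v w; rewrite -(coset_repr u) -(coset_repr v) -(coset_repr w).
by rewrite !coset_mul mulgA.
Qed.

Lemma quotient_mul1 : left_id quotient_one quotient_mul.
Proof. by move=> u; rewrite -(coset_repr u) coset_mul mul1g. Qed.

Lemma quotient_mul1r : right_id quotient_one quotient_mul.
Proof. by move=> u; rewrite -(coset_repr u) coset_mul mulg1. Qed.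

Lemma quotient_mulV : left_inverse quotient_one quotient_inv quotient_mul.
Proof. by move=> u; rewrite -(coset_repr u) coset_inv coset_mul mulVg. Qed.

Lemma quotient_mulVr : right_inverse quotient_one quotient_inv quotient_mul.
Proof. by move=> u; rewrite -(coset_repr u) coset_inv coset_mul mulgV. Qed.

HB.instance Definition _ := isGroup.Build quotient_group
  quotient_mulA quotient_mul1 quotient_mul1r quotient_mulV quotient_mulVr.

Lemma cosetM (x y : G) : coset (x * y) = coset x * coset y.
Proof. by rewrite -coset_mul. Qed.

HB.instance Definition _ :=
  isMultiplicative.Build G quotient_group coset cosetM.

End QuotientGroup.

Section FreeGroup.
Variable X : choiceType.

(* A letter [(x, true)] stands for the generator [x] and [(x, false)] for its *)
(* inverse.                                                                   *)
Definition letter : Type := (X * bool)%type.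
Definition inv_letter (l : letter) : letter := (l.1, ~~ l.2).
Definition inv_word (w : seq letter) : seq letter := rev (map inv_letter w).

Inductive word_equiv : seq letter -> seq letter -> Prop :=
| word_cancel u l v : word_equiv (u ++ l :: inv_letter l :: v) (u ++ v)
| word_refl u : word_equiv u u
| word_sym u v : word_equiv u v -> word_equiv v u
| word_trans u v w : word_equiv u v -> word_equiv v w -> word_equiv u w.

Lemma inv_letterK : involutive inv_letter.
Proof. by case=> x e; rewrite /inv_letter /= negbK. Qed.

Lemma inv_wordK : involutive inv_word.
Proof. by move=> w; rewrite /inv_word map_rev revK (mapK inv_letterK). Qed.

Lemma inv_word_cat u v : inv_word (u ++ v) = inv_word v ++ inv_word u.
Proof. by rewrite /inv_word map_cat rev_cat. Qed.

Lemma word_equiv_cat u u' v v' :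
  word_equiv u u' -> word_equiv v v' -> word_equiv (u ++ v) (u' ++ v').
Proof.
move=> uu' vv'; apply: (@word_trans _ (u' ++ v)).
  elim: uu' => [u1 l v1|u1|u1 v1 _|u1 v1 w1 _ IH1 _ IH2].
  - by rewrite -!catA /=; apply: word_cancel.
  - exact: word_refl.
  - exact: word_sym.
  - exact: word_trans IH1 IH2.
elim: vv' => [u1 l v1|u1|u1 v1 _|u1 v1 w1 _ IH1 _ IH2].
- by rewrite !catA; apply: word_cancel.
- exact: word_refl.
- exact: word_sym.
- exact: word_trans IH1 IH2.
Qed.

Lemma word_equiv_inv u v : word_equiv u v -> word_equiv (inv_word u) (inv_word v).
Proof.
elim=> {u v} [u l v|u|u v _|u v w _ IH1 _ IH2].
- rewrite !inv_word_cat /inv_word !map_cons inv_letterK !rev_cons -!cats1.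
  by rewrite -!catA; apply: word_cancel.
- exact: word_refl.
- exact: word_sym.
- exact: word_trans IH1 IH2.
Qed.

Lemma word_equiv_mulV u : word_equiv (u ++ inv_word u) [::].
Proof.
elim/last_ind: u => [|u l IHu]; first exact: word_refl.
rewrite /inv_word map_rcons rev_rcons cat_rcons.
exact: word_trans (word_cancel _ _ _) IHu.
Qed.

Definition word_eqb (u v : seq letter) : bool := `[< word_equiv u v >].

Lemma word_eqb_refl : reflexive word_eqb.
Proof. by move=> u; apply/asboolP/word_refl. Qed.

Lemma word_eqb_sym : symmetric word_eqb.
Proof. by move=> u v; apply/asboolP/asboolP => /word_sym. Qed.

Lemma word_eqb_trans : transitive word_eqb.
Proof.
by move=> v u w /asboolP uv /asboolP vw; apply/asboolP/(word_trans uv vw).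
Qed.

Canonical word_equivrel :=
  EquivRel word_eqb word_eqb_refl word_eqb_sym word_eqb_trans.

Definition free_group : Type := {eq_quot word_equivrel}.

HB.instance Definition _ := Choice.on free_group.
HB.instance Definition _ := Quotient.on free_group.

Definition word_class (w : seq letter) : free_group := \pi w.

Lemma word_classP u v : word_class u = word_class v <-> word_equiv u v.
Proof.
split=> [/eqquotP/asboolP // | uv]; apply/eqquotP; exact/asboolP.
Qed.

Lemma word_class_repr (x : free_group) : word_class (repr x) = x.
Proof. exact: reprK. Qed.

Definition free_one : free_group := word_class [::].
Definition free_mul (x y : free_group) := word_class (repr x ++ repr y).
Definition free_inv (x : free_group) := word_class (inv_word (repr x)).

Lemma free_mul_class u v :
  free_mul (word_class u) (word_class v) = word_class (u ++ v).
Proof.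
by apply/word_classP/word_equiv_cat; apply/word_classP/word_class_repr.
Qed.

Lemma free_inv_class u : free_inv (word_class u) = word_class (inv_word u).
Proof. by apply/word_classP/word_equiv_inv/word_classP/word_class_repr. Qed.

Lemma free_mulA : associative free_mul.
Proof.
move=> x y z; rewrite -(word_class_repr x) -(word_class_repr y).
by rewrite -(word_class_repr z) !free_mul_class catA.
Qed.

Lemma free_mul1 : left_id free_one free_mul.
Proof. by move=> x; rewrite -(word_class_repr x) free_mul_class. Qed.

Lemma free_mul1r : right_id free_one free_mul.
Proof. by move=> x; rewrite -(word_class_repr x) free_mul_class cats0. Qed.

Lemma free_mulVr : right_inverse free_one free_inv free_mul.
Proof.
move=> x; rewrite -(word_class_repr x) free_inv_class free_mul_class.
exact/word_classP/word_equiv_mulV.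
Qed.

Lemma free_mulV : left_inverse free_one free_inv free_mul.
Proof.
move=> x; rewrite -(word_class_repr x) free_inv_class free_mul_class.
apply/word_classP; rewrite -[X in _ ++ X]inv_wordK; exact: word_equiv_mulV.
Qed.

HB.instance Definition _ := isGroup.Build free_group
  free_mulA free_mul1 free_mul1r free_mulV free_mulVr.

Definition free_gen (x : X) : free_group := word_class [:: (x, true)].

End FreeGroup.

(* The group [< X | rels >], where a relator [r] stands for the relation r = 1 *)
Definition presented_group (X : choiceType) (rels : set (free_group X)) :
    groupType :=
  quotient_group (normal_closure_normal rels).

Definition expgz (G : groupType) (x : G) (k : int) : G :=
  match k with Posz i => x ^+ i | Negz i => x ^- i.+1 end.

(* The relation a^-1 b^m a = b^n, as the relator a^-1 b^m a (b^n)^-1 over the  *)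
(* two-letter alphabet [bool].                                                *)
Definition BS_relator (m n : int) : free_group bool :=
  let a := free_gen true in let b := free_gen false in
  a^-1 * expgz b m * a * (expgz b n)^-1.

Definition BS (m n : int) : groupType := presented_group [set BS_relator m n].

(* [[~ x, y]] is x^-1 y^-1 x y; the other convention generates the same        *)
(* subgroup when A and B are subgroups.                                       *)
Definition commutator_subgroup (G : groupType) (A B : set G) : set G :=
  generated [set z | exists x y, [/\ A x, B y & z = [~ x, y]]].

(* Indexed from 1: [lower_central G 1 = setT]; the value at 0 is also [setT].  *)
Definition lower_central (G : groupType) (i : nat) : set G :=
  iter i.-1 (commutator_subgroup setT) setT.
Arguments lower_central : clear implicits.

Lemma lower_central_normal (G : groupType) (i : nat) :
  is_normal_subgroup (lower_central G i).
Proof.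
rewrite /lower_central; elim: i.-1 => [|k [[N1 NM NV] NJ]]; first by split.
split; first exact: generated_subgroup.
rewrite iterS; set N := iter _ _ _ in N1 NM NV NJ *.
move=> x y Cx H [[H1 HM HV] HC].
apply: (Cx (fun g => H (g ^ y))); split; first split.
- by rewrite conj1g.
- by move=> u v Hu Hv; rewrite conjMg; apply: HM.
- by move=> u Hu; rewrite conjVg; apply: HV.
- move=> _ [u [v [_ Nv ->]]]; rewrite conjRg; apply: HC.
  by exists (u ^ y), (v ^ y); split=> //; apply: NJ.
Qed.

Definition twisted_conj (G : groupType) (phi : G -> G) (x y : G) : Prop :=
  exists z, x = z * y * (phi z)^-1.

Definition reidemeister_classes (G : groupType) (phi : G -> G) : set (set G) :=
  range (fun y => [set x | twisted_conj phi x y]).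

Definition R_infinity (G : groupType) : Prop :=
  forall phi : {multiplicative G -> G}, bijective phi ->
    infinite_set (reidemeister_classes phi).

Definition quotient_R_infinity (G : groupType) (c : nat) : bool :=
  (0 < c)%N &&
  `[< R_infinity (quotient_group (lower_central_normal G c.+1)) >].

(* [None] is the degree infinity.                                             *)
Definition R_infinity_nilpotency_degree (G : groupType) : option nat :=
  if pselect (exists c, quotient_R_infinity G c) is left exc
  then Some (ex_minn exc) else None.

(* Main.v *)
From HB Require Import structures.
Require Import Defs.
From mathcomp Require Import all_boot all_order all_algebra.
From mathcomp Require Import perm ring zify.
From mathcomp Require Import all_classical.

Set Implicit Arguments.
Unset Strict Implicit.
Unset Printing Implicit Defensive.

Import Order.TTheory GRing.Theory Num.Theory.
Local Open Scope classical_set_scope.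
Local Open Scope quotient_scope.
Local Open Scope group_scope.

(** Put d = n - m, which is prime to m and to n, and let Q be the quotient of
BS(m,n) by the (c+1)-st term of the lower central series.  The relation says
that the commutator of b^m with a is b^d, so by induction b^(d^k) lies in
gamma_(k+1), and b^(d^c) = 1 in Q.  Since m and n are prime to d^c, conjugation
by a and by a^-1 preserves the subgroup generated by b, every element of Q is
some a^i b^j, and a acts on b as multiplication of the exponent by n/m modulo
d^c.  Whether Q has the R-infinity property depends only on whether n/m is its
own inverse modulo d^c, that is, on whether d^c divides n^2 - m^2
([quotient_R_infinityE]).

If it does divide, a -> a^-1, b -> b^-1 defines an automorphism of Q
([not_R_infinity_of_dvd]).  Twisted conjugation by a power of a then changes
the exponent i of a^i b^j by an even number, and the exponent of b only matters
modulo d^c (or modulo 2 when d = 0, where Q is abelian and the same parity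
argument applies to b), so the number of classes is finite.

If it does not divide, then b has finite order in Q and any automorphism sends
b to a power of b and a to a^(+1 or -1) b^s.  The sign -1 would force
b^(n^2 - m^2) = 1 by injectivity, hence the sign is +1, the exponent of a is
constant on twisted conjugacy classes, and there are infinitely many of them
([R_infinity_metacyclic]).  This needs the lower bound on the order of b: no
power b^k with k not divisible by d^c lies in gamma_(c+1).  It comes from the
action of BS(m,n) on Z/d^c by the affine permutations a : x -> (n/m) x and
b : x -> x + 1, under which gamma_(i+1) acts by maps x -> w x + y with w = 1
modulo d^(i+1) and y = 0 modulo d^i ([lower_central_BS_exponent]).

Finally n^2 - m^2 = d (n + m).  If d = 0, or d = 1, or n + m = 0, all the
divisibilities hold and the degree is infinite.  If d is not zero, the degree is
the least c >= 1 such that d^(c-1) does not divide n + m = 2 m + d; for c = 2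
this says that d does not divide 2 m, i.e. that |d| > 2, and for d = 2 one
compares 2^(c-1) with 2 m + 2. *)

(** * Integer powers in a group *)

Lemma expgz1 (G : groupType) (x : G) : expgz x 1 = x.
Proof. by []. Qed.

Lemma expgzN (G : groupType) (x : G) k : expgz x (- k)%R = (expgz x k)^-1.
Proof. by case: k => [[|k]|k] //=; rewrite ?invg1 ?invgK. Qed.

Lemma expgzS (G : groupType) (x : G) k : expgz x (k + 1)%R = expgz x k * x.
Proof.
case: k => [k|[|k]]; first by rewrite -PoszD addn1 /= expgSr.
  by rewrite /= expg1 mulVg.
have -> : (Negz k.+1 + 1)%R = Negz k by lia.
by rewrite /= [in RHS]expgS invgM mulgVK.
Qed.

Lemma expgzD (G : groupType) (x : G) j k :
  expgz x (j + k)%R = expgz x j * expgz x k.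
Proof.
elim/int_rect: k => [|k IHk|k IHk]; first by rewrite addr0 mulg1.
  by rewrite intS [(1 + _)%R]addrC addrA !expgzS IHk mulgA.
apply: (@mulIg _ x); rewrite -mulgA -!expgzS.
have -> : (j - k.+1%:Z + 1 = j - k%:Z)%R by lia.
by have -> : (- k.+1%:Z + 1 = - k%:Z)%R by lia.
Qed.

Lemma expgzM (G : groupType) (x : G) j k :
  expgz x (j * k)%R = expgz (expgz x j) k.
Proof.
elim/int_rect: k => [|k IHk|k IHk]; first by rewrite mulr0.
  by rewrite intS [(1 + _)%R]addrC mulrDr mulr1 expgzD expgzS IHk.
apply: (@mulIg _ (expgz x j)); rewrite -expgzS -expgzD.
have -> : (- k.+1%:Z + 1 = - k%:Z)%R by lia.
by rewrite -IHk; congr expgz; rewrite -[k.+1]addn1 PoszD; ring.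
Qed.

Lemma expgzV (G : groupType) (x : G) k : expgz x^-1 k = (expgz x k)^-1.
Proof. by rewrite -expgzN -[x^-1](expgzN x 1) -expgzM mulN1r. Qed.

Lemma expg1z (G : groupType) k : expgz (1 : G) k = 1.
Proof. by case: k => k /=; rewrite expg1n // invg1. Qed.

Lemma expgzC (G : groupType) (x : G) j k :
  expgz x j * expgz x k = expgz x k * expgz x j.
Proof. by rewrite -!expgzD addrC. Qed.

Lemma expgz_mod (G : groupType) (x : G) N k :
  expgz x N = 1 -> expgz x (k %% N)%Z = expgz x k.
Proof.
move=> xN; rewrite [in RHS](divz_eq k N) [RHS]expgzD.
by rewrite [(_ * N)%R]mulrC expgzM xN expg1z mul1g.
Qed.

Lemma conjg_expgz (G : groupType) (x y : G) k :
  expgz x k ^ y = expgz (x ^ y) k.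
Proof.
by case: k => k /=; rewrite ?conjVg conjXg. Qed.

(** * Homomorphisms out of quotients and presented groups *)

(** A multiplicative map between groups preserves 1, so the morphism laws hold
with multiplicativity as the only assumption; an automorphism in the definition
of the R-infinity property is given in this form. *)
Section GroupHom.
Variables (G H : groupType) (f : {multiplicative G -> H}).

Lemma homg1 : f 1 = 1.
Proof. by apply: (@mulgI _ (f 1)); rewrite -gmulfM !mulg1. Qed.

Lemma homgV : {morph f : x / x^-1}.
Proof. by move=> x; apply/divg1_eq; rewrite invgK -gmulfM mulVg homg1. Qed.

Lemma homgJ : {morph f : x y / x ^ y}.
Proof. by move=> x y; rewrite !conjgE !gmulfM homgV. Qed.

Lemma homgR : {morph f : x y / [~ x, y]}.
Proof. by move=> x y; rewrite !commgEl gmulfM homgJ homgV. Qed.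

Lemma homg_expgz x k : f (expgz x k) = expgz (f x) k.
Proof.
have fX i : f (x ^+ i) = f x ^+ i.
  by elim: i => [|i IHi]; rewrite ?homg1 // !expgS gmulfM IHi.
by case: k => k /=; rewrite ?homgV fX.
Qed.

End GroupHom.

Section QuotientLift.
Variables (G H : groupType) (N : set G) (nN : is_normal_subgroup N).
Variables (f : {multiplicative G -> H}) (fN : forall x, N x -> f x = 1).

(** The proof that [f] kills [N] is an argument so that the multiplicative
structure can be attached to the function itself. *)
Definition quotient_lift (_ : forall x, N x -> f x = 1)
  (u : quotient_group nN) : H := f (repr u).

Lemma quotient_liftE x : quotient_lift fN (coset nN x) = f x.
Proof.
have /cosetP/fN : coset nN (repr (coset nN x)) = coset nN x.
  exact: coset_repr.
by rewrite gmulfM homgV => /mulg1_eq; rewrite invgK.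
Qed.

Lemma quotient_liftM : {morph quotient_lift fN : u v / u * v}.
Proof.
move=> u v; rewrite -(coset_repr u) -(coset_repr v) -cosetM.
by rewrite !quotient_liftE gmulfM.
Qed.

HB.instance Definition _ :=
  isMultiplicative.Build (quotient_group nN) H (quotient_lift fN)
    quotient_liftM.

End QuotientLift.

Section FreeLift.
Variables (X : choiceType) (H : groupType) (h : X -> H).

Definition letter_value (l : letter X) : H := if l.2 then h l.1 else (h l.1)^-1.

Definition word_value (w : seq (letter X)) : H := \prod_(l <- w) letter_value l.

Lemma word_value_equiv u v : word_equiv u v -> word_value u = word_value v.
Proof.
rewrite /word_value; elim=> // {u v} [u l v|u v w _ -> _ -> //].
rewrite !big_cat !big_cons /=; congr (_ * _); rewrite mulgA.
suff -> : letter_value l * letter_value (inv_letter l) = 1 by rewrite mul1g.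
by case: l => x []; rewrite /letter_value /= ?mulgV ?mulVg.
Qed.

Definition free_lift (x : free_group X) : H := word_value (repr x).

Lemma free_liftE w : free_lift (word_class w) = word_value w.
Proof. exact/word_value_equiv/word_classP/word_class_repr. Qed.

Lemma free_liftM : {morph free_lift : x y / x * y}.
Proof.
move=> x y; rewrite -(word_class_repr x) -(word_class_repr y).
by rewrite [_ * _]free_mul_class !free_liftE /word_value big_cat.
Qed.

HB.instance Definition _ :=
  isMultiplicative.Build (free_group X) H free_lift free_liftM.

Lemma free_lift_gen x : free_lift (free_gen x) = h x.
Proof. by rewrite free_liftE /word_value big_cons big_nil mulg1. Qed.

End FreeLift.

Lemma kernel_normal (G H : groupType) (f : {multiplicative G -> H}) :
  is_normal_subgroup [set x | f x = 1].
Proof.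
split; first split=> /= [|x y|x].
- exact: homg1.
- by rewrite gmulfM => -> ->; rewrite mul1g.
- by rewrite homgV => ->; rewrite invg1.
- by move=> x y /= fx1; rewrite homgJ fx1 conj1g.
Qed.

Lemma free_group_ind (X : choiceType) (P : free_group X -> Prop) :
  P 1 -> (forall x y, P y -> P (free_gen x * y)) ->
  (forall x y, P y -> P ((free_gen x)^-1 * y)) -> forall x, P x.
Proof.
move=> P1 PM PV x; rewrite -(word_class_repr x); elim: (repr x) => // -[i b] w.
case: b => [/(PM i)|/(PV i)]; first by rewrite [_ * _]free_mul_class.
by rewrite [_^-1]free_inv_class [_ * _]free_mul_class.
Qed.

Section BaumslagSolitar.
Variables m n : int.

Definition BSa : BS m n := coset _ (free_gen true).
Definition BSb : BS m n := coset _ (free_gen false).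

Lemma BS_rel : expgz BSb m ^ BSa = expgz BSb n.
Proof.
rewrite /BSa /BSb -!homg_expgz -homgJ /=; apply/esym/cosetP.
have -> : (expgz (free_gen false) n)^-1 *
            expgz (free_gen false) m ^ free_gen true
          = BS_relator m n ^ expgz (free_gen false) n.
  by rewrite /BS_relator /= !conjgE !mulgA mulgVK.
have [_ ncJ] := normal_closure_normal [set BS_relator m n].
by apply: ncJ => N [_]; apply.
Qed.

Section Lift.
Variables (H : groupType) (a b : H).
Hypothesis ab_rel : expgz b m ^ a = expgz b n.

(** The universal property of the presentation. *)
Lemma BS_hom :
  exists f : {multiplicative BS m n -> H}, f BSa = a /\ f BSb = b.
Proof.
pose f : {multiplicative free_group bool -> H} :=
  free_lift (fun i : bool => if i then a else b).
have fE i : f (free_gen i) = if i then a else b by exact: free_lift_gen.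
have fN x : normal_closure [set BS_relator m n] x -> f x = 1.
  move/(_ [set x | f x = 1]); apply; split; first exact: kernel_normal.
  move=> _ -> /=; rewrite /BS_relator /= !gmulfM !homgV !homg_expgz /=.
  by rewrite !fE -ab_rel conjgE !mulgA mulgV.
exists (quotient_lift fN : {multiplicative BS m n -> H}).
split; first by rewrite -[RHS](fE true); apply: quotient_liftE.
by rewrite -[RHS](fE false); apply: quotient_liftE.
Qed.

End Lift.

Lemma BS_ind (P : BS m n -> Prop) :
  P 1 -> (forall y, P y -> P (BSa * y)) -> (forall y, P y -> P (BSa^-1 * y)) ->
  (forall y, P y -> P (BSb * y)) -> (forall y, P y -> P (BSb^-1 * y)) ->
  forall x, P x.
Proof.
move=> P1 Pa PaV Pb PbV x; rewrite -(coset_repr x).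
elim/free_group_ind: (repr x) => [|i y IH|i y IH].
- by rewrite homg1.
- by rewrite gmulfM; case: i; [apply: Pa|apply: Pb].
- by rewrite gmulfM homgV; case: i; [apply: PaV|apply: PbV].
Qed.

End BaumslagSolitar.

(** * Lower central series *)

Lemma lower_centralS (G : groupType) i :
  lower_central G i.+2 = commutator_subgroup setT (lower_central G i.+1).
Proof. by []. Qed.

Lemma lower_central_comm (G : groupType) i (x y : G) :
  lower_central G i.+1 y -> lower_central G i.+2 [~ x, y].
Proof. by move=> Gy H [_]; apply; exists x, y. Qed.

(** The lower central series is the fastest descending central filtration.
Letting the filtration live in the target of a homomorphism gives at once
functoriality, nilpotency of quotients, and bounds on images in a concrete
group. *)
Lemma lower_central_filtration (G H : groupType) (f : {multiplicative G -> H})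
    (L : nat -> set H) :
  (forall i, is_subgroup (L i)) -> (forall x, L 0 (f x)) ->
  (forall i x y, L 0 x -> L i y -> L i.+1 [~ x, y]) ->
  forall i x, lower_central G i.+1 x -> L i (f x).
Proof.
move=> subL L0 Lcomm; elim=> [|i IHi] x; first by move=> _; apply: L0.
rewrite lower_centralS => /(_ [set x | L i.+1 (f x)]); apply.
have [L1 LM LV] := subL i.+1; split; first split=> /= [|y z|y].
- by rewrite homg1.
- by rewrite gmulfM; apply: LM.
- by rewrite homgV; apply: LV.
- move=> _ [y [z [_ Gz ->]]] /=; rewrite homgR; apply: Lcomm => //.
  exact: IHi.
Qed.

Lemma lower_central_hom (G H : groupType) (f : {multiplicative G -> H}) i x :
  lower_central G i.+1 x -> lower_central H i.+1 (f x).
Proof.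
apply: (lower_central_filtration (L := fun i => lower_central H i.+1)) => //.
- by move=> j; case: (lower_central_normal H j.+1).
- by move=> j y z _; apply: lower_central_comm.
Qed.

Lemma lower_central_quotient (G : groupType) c
    (u : quotient_group (lower_central_normal G c.+1)) :
  lower_central _ c.+1 u -> u = 1.
Proof.
set Q := quotient_group _ in u *.
pose pi := coset (lower_central_normal G c.+1).
pose L i := [set pi x | x in lower_central G i.+1].
move=> Gu; have : L c u.
  apply: (lower_central_filtration (f := @idfun Q)) Gu
    => [i|v|i _ _ [x _ <-] [y Gy <-]].
  - have [[G1 GM GV] _] := lower_central_normal G i.+1.
    split=> [|_ _ [x Gx <-] [y Gy <-]|_ [x Gx <-]].
    + by exists 1; rewrite // /pi homg1.
    + by exists (x * y); [apply: GM|rewrite /pi gmulfM].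
    + by exists x^-1; [apply: GV|rewrite /pi homgV].
  - by exists (repr v) => //; apply: coset_repr.
  - by exists [~ x, y]; [apply: lower_central_comm|rewrite /pi homgR].
case=> x Gx <-; rewrite -[RHS](homg1 pi); apply/esym/cosetP.
by rewrite invg1 mul1g.
Qed.

(** * Groups of the form a^i b^j *)

Section NormalForm.
Variables (G : groupType) (a b : G) (m n N : int).
Hypotheses (ab_rel : expgz b m ^ a = expgz b n) (bN : expgz b N = 1).
Hypotheses (co_mN : coprimez m N) (co_nN : coprimez n N).

(** As k is invertible modulo the exponent N of b, each power of b is a power of
b^k, so conjugation by c is known on all of them. *)
Lemma conj_cyclic (c : G) k l : expgz b k ^ c = expgz b l -> coprimez k N ->
  forall j, exists i, expgz b j ^ c = expgz b i.
Proof.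
move=> bkc /eqP co_kN j; have [u [v uv]] := Bezoutz k N.
rewrite co_kN in uv; exists (l * (u * j))%R.
have -> : expgz b j = expgz b (k * (u * j))%R.
  have -> : (j = k * (u * j) + N * (v * j))%R by rewrite -[LHS]mul1r -uv; ring.
  rewrite expgzD [expgz b (N * _)%R]expgzM bN expg1z mulg1; congr expgz.
  by rewrite -[in LHS](mul1r j) -uv; ring.
by rewrite expgzM conjg_expgz bkc -expgzM.
Qed.

Lemma conj_cyclicX k j : exists i, expgz b j ^ expgz a k = expgz b i.
Proof.
elim/int_rect: k j => [|k IHk|k IHk] j; first by exists j; rewrite conjg1.
  rewrite -addn1 PoszD expgzS; have [i bi] := IHk j.
  by rewrite conjgM bi; apply: conj_cyclic ab_rel co_mN _.
have -> : (- k.+1%:Z = - k%:Z + - 1)%R by lia.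
rewrite expgzD; have [i bi] := IHk j; rewrite conjgM bi expgzN expgz1.
apply: conj_cyclic co_nN _.
by rewrite -ab_rel conjgK.
Qed.

Lemma normal_form (f : {multiplicative BS m n -> G}) :
  f (BSa m n) = a -> f (BSb m n) = b -> (forall x, exists y, f y = x) ->
  forall x, exists k j, x = expgz a k * expgz b j.
Proof.
move=> fa fb f_surj x; have [y <-] := f_surj x; elim/BS_ind: y => {x}.
- by exists 0%R, 0%R; rewrite homg1 mulg1.
- move=> y [k [j fy]]; exists (1 + k)%R, j.
  by rewrite gmulfM fa fy expgzD mulgA.
- move=> y [k [j fy]]; exists (- 1 + k)%R, j.
  by rewrite gmulfM homgV fa fy expgzD mulgA expgzN.
- move=> y [k [j fy]]; have [i bi] := conj_cyclicX k 1.
  exists k, (i + j)%R.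
  rewrite expgz1 in bi.
  by rewrite gmulfM fb fy mulgA (conjgC b) bi -mulgA -expgzD.
- move=> y [k [j fy]]; have [i bi] := conj_cyclicX k (- 1).
  exists k, (i + j)%R.
  rewrite expgzN expgz1 in bi.
  by rewrite gmulfM homgV fb fy mulgA (conjgC b^-1) bi -mulgA -expgzD.
Qed.

End NormalForm.

(** * Twisted conjugacy *)

Section TwistedConjugacy.
Variables (G : groupType) (phi : {multiplicative G -> G}).

Lemma twisted_conj_trans x y z :
  twisted_conj phi x y -> twisted_conj phi y z -> twisted_conj phi x z.
Proof.
move=> [u ->] [v ->]; exists (u * v).
by rewrite gmulfM invgM !mulgA.
Qed.

Lemma twisted_conj_sym x y : twisted_conj phi x y -> twisted_conj phi y x.
Proof.
move=> [u ->]; exists u^-1.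
by rewrite homgV invgK !mulgA mulVg mul1g mulgVK.
Qed.

Lemma twisted_class_eq x y : twisted_conj phi x y ->
  [set z | twisted_conj phi z x] = [set z | twisted_conj phi z y].
Proof.
move=> xy; apply/seteqP; split=> z /= zx; first exact: twisted_conj_trans xy.
exact/(twisted_conj_trans zx)/twisted_conj_sym.
Qed.

(** Finitely many elements [r i j] that meet every class; two indices match the
two exponents of a normal form. *)
Lemma finite_reidemeister (r : nat -> nat -> G) M1 M2 :
  (forall x, exists i j,
     [/\ (i < M1)%N, (j < M2)%N & twisted_conj phi x (r i j)]) ->
  finite_set (reidemeister_classes phi).
Proof.
move=> repr_r.
pose C (u : nat * nat) := [set z | twisted_conj phi z (r u.1 u.2)].
apply: (@sub_finite_set _ _ [set C u | u in `I_M1 `*` `I_M2]).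
  move=> _ [x _ <-]; have [i [j [ltiM ltjM xij]]] := repr_r x.
  by exists (i, j) => //; apply/esym/twisted_class_eq.
by apply/finite_image/finite_setX; apply: finite_II.
Qed.

Lemma infinite_reidemeister (e : G -> nat) :
  (forall x y, twisted_conj phi x y -> e x = e y) ->
  (forall k, exists x, e x = k) -> infinite_set (reidemeister_classes phi).
Proof.
move=> e_inv e_surj fin; apply: infinite_nat.
apply: (sub_finite_set _ (finite_image (fun C => e (xget 1 C)) fin)) => k _.
have [x <-] := e_surj k; exists [set z | twisted_conj phi z x].
  by exists x.
apply/e_inv; apply: (@xgetPex _ 1 [set z | twisted_conj phi z x]).
by exists x, 1; rewrite homg1 invg1 mul1g mulg1.
Qed.

End TwistedConjugacy.

Section Inversion.
Variables (G : groupType) (a b : G) (m n N : int).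
Hypotheses (ab_rel : expgz b m ^ a = expgz b n) (bN : expgz b N = 1).
Hypotheses (co_mN : coprimez m N) (co_nN : coprimez n N).
Hypothesis nf : forall x, exists k j, x = expgz a k * expgz b j.

(** Twisting by an inverting automorphism makes a^q x a^q conjugate to x, so the
exponent of a can be reduced modulo 2.  If b has finite order nothing more is
needed; in the remaining case a and b commute and the same trick reduces the
exponent of b. *)
Lemma finite_reidemeister_inversion (phi : {multiplicative G -> G}) :
  phi a = a^-1 -> phi b = b^-1 -> N <> 0 \/ commute a b ->
  finite_set (reidemeister_classes phi).
Proof.
move=> phi_a phi_b N0_ab.
pose M : nat := if N == 0 then 2%N else `|N|%N.
apply: (@finite_reidemeister _ _ (fun i j => a ^+ i * b ^+ j) 2 M) => x.
have [k [j ->]] := nf x.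
have [q [r [ltr2 ->]]] : exists q r, (r < 2)%N /\ k = (q * 2 + r%:Z)%R.
  exists (k %/ 2)%Z, `|(k %% 2)%Z|%N; rewrite gez0_abs ?modz_ge0 // -divz_eq.
  by split=> //; rewrite -ltz_nat gez0_abs ?modz_ge0 // ltz_mod.
have [i bi] := conj_cyclicX ab_rel bN co_mN co_nN (- q) j.
(* conjugation by a^q removes the even part of the exponent of a *)
have step1 : twisted_conj phi (expgz a (q * 2 + r%:Z) * expgz b j)
                              (expgz a r%:Z * expgz b i).
  exists (expgz a q).
  rewrite homg_expgz phi_a expgzV invgK -bi conjgE expgzN invgK.
  have -> : (q * 2 + r%:Z = q + r%:Z + q)%R by ring.
  by rewrite !expgzD !mulgA mulgVK.
have [N0|N0] := eqVneq N 0%R.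
  have cab : commute a b by case: N0_ab.
  have /= [s [lts2 iE]] : exists s, (s < 2)%N /\ i = ((i %/ 2)%Z * 2 + s%:Z)%R.
    exists `|(i %% 2)%Z|%N; rewrite gez0_abs ?modz_ge0 // -divz_eq.
    by split=> //; rewrite -ltz_nat gez0_abs ?modz_ge0 // ltz_mod.
  exists r, s; split; rewrite // /M ?N0 //.
  apply: twisted_conj_trans step1 _; exists (expgz b (i %/ 2)%Z).
  rewrite homg_expgz phi_b expgzV invgK.
  have cabX t : a ^+ r * expgz b t = expgz b t * a ^+ r.
    apply/esym; apply: commuteX; apply/commute_sym.
    by case: t => t /=; last apply: commuteV; apply: commuteX.
  rewrite mulgA -cabX -!mulgA; congr (_ * _).
  rewrite -[b ^+ s]/(expgz b s%:Z) -!expgzD; congr expgz.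
  by rewrite [LHS]iE; ring.
exists r, `|(i %% N)%Z|%N; split=> //.
  by rewrite /M (negPf N0) -ltz_nat gez0_abs ?modz_ge0 // ltz_mod.
rewrite -[b ^+ _]/(expgz b (Posz _)) gez0_abs ?modz_ge0 // expgz_mod //.
Qed.

End Inversion.

Lemma expgz_int (x : Algebra.to_multiplicative int) k :
  (expgz x k : int) = ((x : int) * k)%R.
Proof.
elim/int_rect: k => [|k IHk|k IHk]; first by rewrite mulr0.
  by rewrite -addn1 PoszD expgzD [LHS]/(_ + _)%R IHk mulrDr mulr1.
have -> : (- k.+1%:Z = - k%:Z + - 1)%R by lia.
by rewrite expgzD [LHS]/(_ + _)%R IHk mulrDr mulrN1.
Qed.

Section RInfinity.
Variables (G : groupType) (a b : G) (m n N : int).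
Hypotheses (ab_rel : expgz b m ^ a = expgz b n) (bN : expgz b N = 1).
Hypotheses (nf : forall x, exists k j, x = expgz a k * expgz b j).
Variable (e : {multiplicative G -> Algebra.to_multiplicative int}).
Hypotheses (ea : (e a : int) = 1%R) (eb : (e b : int) = 0%R) (N0 : N <> 0).

Let eM x y : (e (x * y) : int) = (e x + e y)%R.
Proof. by rewrite gmulfM. Qed.

Let eX x k : (e (expgz x k) : int) = (e x * k)%R.
Proof. by rewrite homg_expgz expgz_int. Qed.

Lemma exponent_normal_form k j : (e (expgz a k * expgz b j) : int) = k.
Proof.
by rewrite eM !eX ea eb mul1r mul0r addr0.
Qed.

(** The homomorphism e counts occurrences of a.  It satisfies
e (phi x) = eps * e x, with eps = 1 or -1 by surjectivity; eps = 1 makes e a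
class invariant, while eps = -1 makes conjugation by a^-1, like conjugation by
a, send (phi b)^m to (phi b)^n, so that phi kills b^(n^2 - m^2). *)
Lemma R_infinity_metacyclic : expgz b (n ^+ 2 - m ^+ 2)%R <> 1 -> R_infinity G.
Proof.
move=> b_neq phi phi_bij; have [psi psiK phiK] := phi_bij.
have [t phi_b] : exists t, phi b = expgz b t.
  have [k [t phi_b]] := nf (phi b); exists t.
  (* b is torsion, so phi b does not involve a *)
  have : (k * N = 0)%R.
    rewrite -[k](exponent_normal_form k t) -phi_b -eX -homg_expgz bN.
    by rewrite !homg1.
  by move/eqP; rewrite mulf_eq0 => /orP[/eqP k0|/eqP//]; rewrite phi_b k0 mul1g.
have [eps [s phi_a]] := nf (phi a).
have e_phi x : (e (phi x) : int) = (eps * e x)%R.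
  have [k [j ->]] := nf x; rewrite exponent_normal_form gmulfM !homg_expgz.
  rewrite phi_b eM !eX phi_a exponent_normal_form eb.
  by rewrite !mul0r addr0.
have eps1 : (eps * e (psi a) = 1)%R by rewrite -e_phi phiK ea.
have [eps_eq|eps_eq] : eps = 1%R \/ eps = (-1)%R.
- have : (`|eps| * `|e (psi a) : int| = 1)%N by rewrite -abszM eps1.
  by move/eqP; rewrite muln_eq1 => /andP[/eqP epsE _]; lia.
(* natural numbers suffice to tell infinitely many classes apart *)
- pose h (k : int) : nat := if (0 <= k)%R then `|k|%N else 0%N.
  apply: (@infinite_reidemeister _ _ (fun x => h (e x))) => [x y [z ->]|k].
    have eV u : (e u^-1 : int) = (- (e u : int))%R by rewrite homgV.
    by congr h; rewrite !eM eV e_phi eps_eq; ring.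
  by exists (expgz a k); rewrite eX ea mul1r.
case: b_neq; apply: (can_inj psiK); rewrite homg1 homg_expgz phi_b -expgzM.
have step : expgz b (t * m) ^ a^-1 = expgz b (t * n).
  have := congr1 phi ab_rel; rewrite homgJ !homg_expgz phi_b phi_a eps_eq.
  rewrite conjgM expgzN expgz1 -!expgzM => /(canRL (conjgK _)) ->.
  by rewrite conjgE invgK mulgA expgzC mulgK.
have {}step : expgz b (t * m) = expgz b (t * n) ^ a by rewrite -step conjgKV.
have step2 : expgz b (t * m * m) = expgz b (t * n * n).
  rewrite expgzM step -conjg_expgz -expgzM.
  have -> : (t * n * m = m * (t * n))%R by ring.
  by rewrite expgzM conjg_expgz ab_rel -expgzM; congr expgz; ring.
have -> : (t * (n ^+ 2 - m ^+ 2) = t * n * n + - (t * m * m))%R by ring.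
by rewrite expgzD expgzN step2 mulgV.
Qed.

End RInfinity.

(** * Affine permutations of a finite ring *)

Section AffineModel.
Variables (R : finComUnitRingType) (m n : int).
Hypotheses (m_unit : (m%:~R : R)%R \is a GRing.unit).
Hypotheses (n_unit : (n%:~R : R)%R \is a GRing.unit).

Let D : R := (n%:~R - m%:~R)%R.

Definition affine (s : {perm R}) (w y : R) := forall t, s t = (w * t + y)%R.

(** A central filtration of the group of affine maps x -> w x + y with w
congruent to 1 modulo D.  At level i the slope is asked to be 1 modulo D^(i+1)
and the translation to be divisible by D^i, so that a commutator with a member
of level 0 gains one factor D in both. *)
Definition affine_filtration (i : nat) : set {perm R} :=
  [set s | exists v y, (1 + D ^+ i.+1 * v)%R \is a GRing.unit /\
                       affine s (1 + D ^+ i.+1 * v)%R (D ^+ i * y)%R].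

Lemma affine_filtration_subgroup i : is_subgroup (affine_filtration i).
Proof.
split=> [|s1 s2 [v1 [y1 [U1 A1]]] [v2 [y2 [U2 A2]]]|s [v [y [U A]]]].
- exists 0%R, 0%R; rewrite mulr0 addr0 unitr1; split=> // t.
  by rewrite perm1 mulr0 addr0 mul1r.
- have E : (1 + D ^+ i.+1 * (v1 + v2 + D ^+ i.+1 * v1 * v2) =
          (1 + D ^+ i.+1 * v2) * (1 + D ^+ i.+1 * v1))%R by ring.
  exists (v1 + v2 + D ^+ i.+1 * v1 * v2)%R, ((1 + D ^+ i.+1 * v2) * y1 + y2)%R.
  by rewrite E unitrM U1 U2; split=> // t; rewrite permM A2 A1; ring.
set w := (1 + _)%R in U A.
have E : (1 + D ^+ i.+1 * (- (v / w)) = w^-1)%R.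
  apply: (mulIr U); rewrite mulVr // mulrDl mul1r mulrN mulNr mulrA.
  by rewrite divrK // /w addrK.
exists (- (v / w))%R, (- (y / w))%R; rewrite E unitrV; split=> // t.
apply: (canLR (permK s)); rewrite A mulrDr mulrA mulrV // mul1r.
have -> : (w * (D ^+ i * - (y / w)) = - (D ^+ i * y) * (w / w))%R.
  by move: w^-1%R => w'; ring.
by rewrite mulrV // mulr1 -addrA addNr addr0.
Qed.

(** The maps s1 s2 and s2 s1 have the same slope, so the commutator is a
translation, by (w2 - 1) y1 - (w1 - 1) y2. *)
Lemma affine_filtration_comm i s1 s2 : affine_filtration 0 s1 ->
  affine_filtration i s2 -> affine_filtration i.+1 [~ s1, s2].
Proof.
move=> [v1 [y1 [U1 A1]]] [v2 [y2 [U2 A2]]].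
exists 0%R, (v2 * y1 - v1 * y2)%R.
rewrite mulr0 addr0 unitr1; split=> // t.
have [t' <-] : exists t', s1 (s2 t') = t.
  by exists (s2^-1 (s1^-1 t)); rewrite !permKV.
have -> : [~ s1, s2] (s1 (s2 t')) = s2 (s1 t').
  have := congr1 (fun s : {perm R} => s t') (commgC s1 s2).
  by rewrite !permM => ->.
by rewrite !(A1, A2) !exprS; ring.
Qed.

Let ratio_inj : injective (fun x : R => n%:~R / m%:~R * x)%R.
Proof. by apply: mulrI; rewrite unitrM n_unit unitrV m_unit. Qed.

Definition scale_perm : {perm R} := perm ratio_inj.
Definition shift_perm : {perm R} := perm (@addIr R 1%R).

Lemma expgz_shift_perm k t : expgz shift_perm k t = (t + k%:~R)%R.
Proof.
elim/int_rect: k t => [|k IHk|k IHk] t; first by rewrite perm1 addr0.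
  by rewrite -addn1 PoszD expgzS permM IHk permE intrD addrA.
apply: (@perm_inj _ shift_perm); rewrite -permM -expgzS !permE.
have -> : (- k.+1%:Z + 1 = - k%:Z)%R by lia.
by rewrite IHk -addn1 PoszD opprD intrD addrA subrK.
Qed.

Lemma affine_rel : expgz shift_perm m ^ scale_perm = expgz shift_perm n.
Proof.
apply/permP => t; rewrite -[t](permKV scale_perm) permJ !expgz_shift_perm.
by rewrite !permE mulrDr divrK.
Qed.

(** If D^c = 0, level c of the filtration is trivial, so gamma_(c+1) acts
trivially, whereas b^k acts as translation by k. *)
Lemma lower_central_BS_exponent c k : (D ^+ c = 0)%R ->
  lower_central (BS m n) c.+1 (expgz (BSb m n) k) -> (k%:~R = 0 :> R)%R.
Proof.
move=> Dc; have [f [fa fb]] := BS_hom affine_rel.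
have [L1 LM LV] := affine_filtration_subgroup 0.
have La : affine_filtration 0 scale_perm.
  have E : (1 + D ^+ 1 * m%:~R^-1 = n%:~R / m%:~R)%R.
    by rewrite expr1 mulrBl mulrV // addrC subrK.
  exists (m%:~R^-1)%R, 0%R; rewrite E unitrM n_unit unitrV m_unit; split=> // t.
  by rewrite permE mulr0 addr0.
have Lb : affine_filtration 0 shift_perm.
  exists 0%R, 1%R; rewrite mulr0 addr0 unitr1; split=> // t.
  by rewrite permE mul1r expr0 mulr1.
have L0 x : affine_filtration 0 (f x).
  elim/BS_ind: x => [|x Lx|x Lx|x Lx|x Lx]; rewrite ?homg1 //.
  - by rewrite gmulfM fa; apply: LM.
  - by rewrite gmulfM homgV fa; apply: LM => //; apply: LV.
  - by rewrite gmulfM fb; apply: LM.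
  - by rewrite gmulfM homgV fb; apply: LM => //; apply: LV.
move/(lower_central_filtration affine_filtration_subgroup L0
        affine_filtration_comm).
rewrite homg_expgz fb => -[v [y [_ /(_ 0%R)]]].
by rewrite expgz_shift_perm exprS Dc !(mulr0, mul0r) addr0 add0r.
Qed.

End AffineModel.

(** * Nilpotent quotients of Baumslag-Solitar groups *)

Lemma intr_Zp_eq0 (N : nat) (k : int) : (1 < N)%N ->
  (k%:~R == 0 :> 'Z_N)%R = (N %| k)%Z.
Proof.
move=> N_gt1; have natE (i : nat) : ((i%:R : 'Z_N) == 0)%R = (N %| i)%N.
  by rewrite -val_eqE /= val_Zp_nat.
by case: k => k; rewrite ?NegzE ?mulrNz ?oppr_eq0 ?dvdzN; apply: natE.
Qed.

Lemma intr_Zp_unit (N : nat) (k : int) : (1 < N)%N -> coprimez k N ->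
  (k%:~R : 'Z_N)%R \is a GRing.unit.
Proof.
move=> N_gt1 /eqP co_kN; have [u [v uv]] := Bezoutz k N.
apply/unitrPr; exists (u%:~R)%R; rewrite co_kN in uv.
have /eqP N0 : ((N%:Z)%:~R == 0 :> 'Z_N)%R by rewrite intr_Zp_eq0.
rewrite -[RHS](congr1 (fun i : int => i%:~R : 'Z_N)%R uv) intrD !intrM N0.
by ring.
Qed.

Lemma subgroup_expgz (G : groupType) (H : set G) x k :
  is_subgroup H -> H x -> H (expgz x k).
Proof.
move=> [H1 HM HV] Hx; elim/int_rect: k => [//|k IHk|k IHk].
  by rewrite -addn1 PoszD expgzS; apply: HM.
have -> : (- k.+1%:Z = - k%:Z + - 1)%R by lia.
by rewrite expgzD; apply: HM => //; rewrite expgzN expgz1; apply: HV.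
Qed.

Section NilpotentQuotient.
Variables (m n : int) (c : nat).
Hypotheses (co_mn : gcdz m n = 1%R) (c_gt0 : (0 < c)%N).

Let d : int := (n - m)%R.
Let Q : groupType := quotient_group (lower_central_normal (BS m n) c.+1).
Let pi : {multiplicative BS m n -> Q} :=
  coset (lower_central_normal (BS m n) c.+1).
Let a := pi (BSa m n).
Let b := pi (BSb m n).

(** The commutator of b^(m d^k) with a is b^((n - m) d^k). *)
Lemma lower_central_BSb k :
  lower_central (BS m n) k.+1 (expgz (BSb m n) (d ^+ k)%R).
Proof.
elim: k => [//|k IHk]; set b0 := BSb m n in IHk *; set a0 := BSa m n.
have rel : expgz b0 m ^ a0 = expgz b0 n := BS_rel m n.
have [[_ _ GV] _] := lower_central_normal (BS m n) k.+2.
have GX : lower_central (BS m n) k.+1 (expgz b0 (d ^+ k * m)%R).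
  rewrite expgzM; apply: subgroup_expgz IHk.
  by case: (lower_central_normal (BS m n) k.+1).
have -> : expgz b0 (d ^+ k.+1)%R = [~ expgz b0 (d ^+ k * m)%R, a0].
  have bJ : expgz b0 (d ^+ k * m)%R ^ a0 = expgz b0 (d ^+ k * n)%R.
    by rewrite mulrC [in LHS]expgzM conjg_expgz rel -expgzM mulrC.
  rewrite commgEl bJ -expgzN -expgzD; congr expgz.
  by rewrite exprS /d; ring.
by rewrite -invgR; apply: GV; apply: lower_central_comm.
Qed.

Lemma quotient_ab_rel : expgz b m ^ a = expgz b n.
Proof. by have := congr1 pi (BS_rel m n); rewrite homgJ !homg_expgz. Qed.

Lemma pi_eq1 x : pi x = 1 <-> lower_central (BS m n) c.+1 x.
Proof.
have [[_ _ GV] _] := lower_central_normal (BS m n) c.+1.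
rewrite -(homg1 pi); split=> [/cosetP/GV|Gx]; rewrite ?mulg1 ?invgK //.
by apply/cosetP; rewrite mulg1; apply: GV.
Qed.

Lemma quotient_b_order : expgz b (d ^+ c)%R = 1.
Proof. by rewrite -homg_expgz; apply/pi_eq1/lower_central_BSb. Qed.

Lemma coprime_m_d : coprimez m (d ^+ c)%R.
Proof.
apply: coprimezXr; apply/eqP.
by rewrite -[RHS]co_mn -(gcdzDr m d) /d subrK.
Qed.

Lemma coprime_n_d : coprimez n (d ^+ c)%R.
Proof.
apply: coprimezXr; rewrite -coprimezN; apply/eqP.
by rewrite -[RHS]co_mn [RHS]gcdzC -(gcdzDr n (- d)%R) /d opprB subrK.
Qed.

Lemma quotient_normal_form x : exists k j, x = expgz a k * expgz b j.
Proof.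
apply: (normal_form quotient_ab_rel quotient_b_order coprime_m_d coprime_n_d
          (f := pi)) => // u.
by exists (repr u); apply: coset_repr.
Qed.

Lemma quotient_lift_exists (H : groupType) (f : {multiplicative BS m n -> H}) :
  (forall x, lower_central (BS m n) c.+1 x -> f x = 1) ->
  exists g : {multiplicative Q -> H}, forall x, g (pi x) = f x.
Proof.
move=> fN; exists (quotient_lift fN : {multiplicative Q -> H}) => x.
exact: quotient_liftE.
Qed.

Lemma R_infinity_of_ndvd :
  ~~ ((d ^+ c)%R %| (n ^+ 2 - m ^+ 2)%R)%Z -> R_infinity Q.
Proof.
move=> ndvd; set N := (`|d| ^ c)%N.
have dN : `|(d ^+ c)%R|%N = N by rewrite abszX.
have ndvdN : ~~ (N %| (n ^+ 2 - m ^+ 2)%R)%Z by move: ndvd; rewrite !dvdzE dN.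
have N_neq0 : N <> 0%N.
  move=> N0; case/negP: ndvd; have : (d ^+ c == 0)%R by rewrite -absz_eq0 dN N0.
  rewrite expf_eq0 c_gt0 => /eqP d0.
  by rewrite subr_sqr -/d d0 mul0r dvdz0.
have N_gt1 : (1 < N)%N.
  case: {dN} N ndvdN N_neq0 => [|[|N]] // /negP[]; exact: dvd1z.
(* the exponent of a, a homomorphism to the additive group of integers *)
have [e0 [e0a e0b]] :
    exists f : {multiplicative BS m n -> Algebra.to_multiplicative int},
      (f (BSa m n) : int) = 1%R /\ (f (BSb m n) : int) = 0%R.
  have rel : expgz (0%R : Algebra.to_multiplicative int) m ^ (1%R : int) =
             expgz (0%R : Algebra.to_multiplicative int) n.
    by rewrite !expg1z conj1g.
  exact: BS_hom rel.
have [e eE] : exists e : {multiplicative Q -> Algebra.to_multiplicative int},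
    forall x, e (pi x) = e0 x.
  apply: quotient_lift_exists; case: (c) c_gt0 => // c' _ x.
  (* the target is abelian, so the filtration may stop after one step *)
  apply: (lower_central_filtration
    (L := fun i => if i is 0 then setT else [set 1]))
    => [[|i]|//|[|i] y z _] //.
  - split=> [|u v|u] //=; first by move=> -> ->; rewrite mulg1.
    by move=> ->; rewrite invg1.
  - by move=> _; apply/eqP/commgP/Algebra.commuteT.
  - by move=> ->; rewrite commg1.
have dc0 : (d ^+ c)%R <> 0%R by move=> dc; rewrite dc in dN; case: N_neq0.
apply: (R_infinity_metacyclic quotient_ab_rel quotient_b_order
          quotient_normal_form (e := e)) => //.
- by rewrite /a eE.
- by rewrite /b eE.
rewrite -homg_expgz => /pi_eq1 Gb; case/negP: ndvdN.
rewrite -intr_Zp_eq0 //; apply/eqP; apply: lower_central_BS_exponent Gb.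
- by apply: intr_Zp_unit => //; have := coprime_m_d; rewrite !coprimezE dN.
- by apply: intr_Zp_unit => //; have := coprime_n_d; rewrite !coprimezE dN.
by rewrite -intrB -rmorphXn; apply/eqP; rewrite intr_Zp_eq0 // !dvdzE dN.
Qed.

(** The map a -> a^-1, b -> b^-1 respects the relation of BS(m,n) in Q when
a b^m a^-1 = b^n there, which holds as soon as b^(m^2) = b^(n^2) and b is a
power of b^n. *)
Lemma not_R_infinity_of_dvd :
  ((d ^+ c)%R %| (n ^+ 2 - m ^+ 2)%R)%Z -> ~ R_infinity Q.
Proof.
move=> dvd R_inf.
have b_sqr : expgz b (n ^+ 2)%R = expgz b (m ^+ 2)%R.
  rewrite -[in LHS](subrK (m ^+ 2) (n ^+ 2))%R expgzD.
  have /dvdzP[q ->] := dvd.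
  by rewrite mulrC expgzM quotient_b_order expg1z mul1g.
have rel : expgz b m ^ a^-1 = expgz b n.
  have ban : expgz b n ^ a^-1 = expgz b m by rewrite -quotient_ab_rel conjgK.
  have /coprimezP[[v w] /= vw] := coprime_n_d.
  have bE k : expgz b k = expgz b (n * (v * k))%R.
    have -> : (n * (v * k) = k + d ^+ c * - (w * k))%R.
      rewrite -[X in (_ = X + _)%R]mul1r -vw; ring.
    rewrite [RHS]expgzD [expgz b (d ^+ c * _)%R]expgzM.
    by rewrite quotient_b_order expg1z mulg1.
  rewrite bE expgzM conjg_expgz ban -expgzM [RHS]bE.
  have -> : (m * (v * m) = m ^+ 2 * v)%R by ring.
  have -> : (n * (v * n) = n ^+ 2 * v)%R by ring.
  by rewrite (expgzM b (m ^+ 2)%R) (expgzM b (n ^+ 2)%R) b_sqr.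
have [f [fa fb]] : exists f : {multiplicative BS m n -> Q},
    f (BSa m n) = a^-1 /\ f (BSb m n) = b^-1.
  by apply: BS_hom; rewrite !expgzV conjVg rel.
have [g gE] : exists g : {multiplicative Q -> Q}, forall x, g (pi x) = f x.
  apply: quotient_lift_exists => x /(lower_central_hom f).
  exact: lower_central_quotient.
have ga : g a = a^-1 by rewrite gE.
have gb : g b = b^-1 by rewrite gE.
have gK : involutive g.
  move=> x; have [k [j ->]] := quotient_normal_form x.
  by rewrite !gmulfM !homg_expgz ga gb !homgV ga gb !invgK.
apply: (R_inf g); first by exists g.
apply: (finite_reidemeister_inversion quotient_ab_rel quotient_b_order
          coprime_m_d coprime_n_d quotient_normal_form) => //.
have [/eqP dc|/eqP dc] := eqVneq (d ^+ c)%R 0%R; last by left.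
(* here n = m, and coprimality leaves m = 1 or m = -1 *)
right; rewrite expf_eq0 c_gt0 /d subr_eq0 in dc.
have nm : n = m by apply/eqP.
have m1 : `|m|%N = 1%N by move: co_mn; rewrite nm gcdzz => -[].
have : expgz b m ^ a = expgz b m by rewrite quotient_ab_rel nm.
have [->|->] : m = 1%R \/ m = (-1)%R by lia.
  by rewrite !expgz1 => /conjg_fixP/commgP/commute_sym.
by rewrite !expgzN !expgz1 conjVg => /invg_inj/conjg_fixP/commgP/commute_sym.
Qed.

Lemma quotient_R_infinityE :
  quotient_R_infinity (BS m n) c = ~~ ((d ^+ c)%R %| (n ^+ 2 - m ^+ 2)%R)%Z.
Proof.
rewrite /quotient_R_infinity c_gt0 /=; apply/asboolP/idP => [R_inf|].
  by apply/negP => /not_R_infinity_of_dvd.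
exact: R_infinity_of_ndvd.
Qed.

End NilpotentQuotient.

(** * The nilpotency degree *)

Lemma degree_Some (G : groupType) c : quotient_R_infinity G c ->
  (forall c', (c' < c)%N -> ~~ quotient_R_infinity G c') ->
  R_infinity_nilpotency_degree G = Some c.
Proof.
move=> Gc min_c; rewrite /R_infinity_nilpotency_degree.
case: pselect => [exc|[]]; last by exists c.
congr Some; case: ex_minnP => c' Gc' min_c'.
apply/eqP; rewrite eqn_leq min_c' //= leqNgt.
by apply/negP => /min_c; rewrite Gc'.
Qed.

Lemma degree_None (G : groupType) :
  (forall c, ~~ quotient_R_infinity G c) ->
  R_infinity_nilpotency_degree G = None.
Proof.
move=> noc; rewrite /R_infinity_nilpotency_degree.
by case: pselect => // -[c Gc]; have := noc c; rewrite Gc.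
Qed.

Section Degree.
Variables m n : int.
Hypothesis co_mn : gcdz m n = 1%R.

Let d := (n - m)%R.

Lemma BS_degree_None :
  (forall c, (0 < c)%N -> ((d ^+ c)%R %| (d * (n + m))%R)%Z) ->
  R_infinity_nilpotency_degree (BS m n) = None.
Proof.
move=> dvd; apply: degree_None => -[//|c].
by rewrite quotient_R_infinityE // negbK subr_sqr; apply: dvd.
Qed.

(** One factor d of n^2 - m^2 = d (n + m) cancels, hence the shift between the
degree and the exponent. *)
Lemma BS_degree_Some c : d != 0%R -> (0 < c)%N ->
  ~~ ((d ^+ c)%R %| (n + m)%R)%Z ->
  (forall c', (c' < c)%N -> ((d ^+ c')%R %| (n + m)%R)%Z) ->
  R_infinity_nilpotency_degree (BS m n) = Some c.+1.
Proof.
move=> d0 c_gt0 ndvd dvd; apply: degree_Some => [|[//|c']].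
  by rewrite quotient_R_infinityE // subr_sqr -/d exprS dvdz_mul2l.
rewrite ltnS => ltc; rewrite quotient_R_infinityE // negbK subr_sqr -/d exprS.
by rewrite dvdz_mul2l //; apply: dvd.
Qed.

Lemma BS_degree_2 : (2 < `|d|)%N ->
  R_infinity_nilpotency_degree (BS m n) = Some 2%N.
Proof.
move=> d_gt2; apply: BS_degree_Some => //; first by rewrite -absz_gt0; lia.
  apply/negP; rewrite expr1.
  have -> : (n + m = 2 * m + d)%R by rewrite /d; ring.
  have : coprimez d m.
    by have := coprime_m_d 1 co_mn; rewrite expr1 coprimez_sym.
  move=> co_dm; rewrite rpredDr ?dvdzz // Gauss_dvdzl // dvdzE => /dvdn_leq.
  by lia.
by case=> // _; rewrite expr0 dvd1z.
Qed.

End Degree.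

Local Open Scope ring_scope.

Theorem theorem4p5 (m n : int) (p : nat)
    (m_gt0 : 0 < m) (le_mn : m <= `|n|) (co_mn : gcdz m n = 1)
    (p_dvd : ((2 ^+ p : int) %| 2 * m + 2)%Z)
    (p_max : forall q : nat, ((2 ^+ q : int) %| 2 * m + 2)%Z -> (q <= p)%N) :
  let r := R_infinity_nilpotency_degree (BS m n) in
  (n < -1 -> r = Some 2%N) /\
  (n = -1 -> m = 1 /\ r = None) /\
  (n = m -> n = 1 /\ m = 1 /\ r = None) /\
  (n - m = 1 -> r = None) /\
  (n - m = 2 -> r = Some (p + 2)%N) /\
  (n - m >= 3 -> r = Some 2%N).
Proof.
move=> r; split; first by move=> n_lt; apply: BS_degree_2 => //; lia.
split.
  move=> n1; have m1 : m = 1 by lia.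
  split=> //; apply: BS_degree_None => // c _.
  by rewrite n1 m1 addNr mulr0 dvdz0.
split.
  move=> nm; have m1 : m = 1 by move: co_mn; rewrite nm gcdzz; lia.
  split; first by rewrite nm.
  split=> //; apply: BS_degree_None => // c c_gt0.
  by rewrite nm subrr mul0r dvdz0.
split.
  by move=> d1; apply: BS_degree_None => // c _; rewrite d1 expr1n dvd1z.
split; last by move=> d_ge3; apply: BS_degree_2 => //; lia.
move=> d2; rewrite addn2.
have nmE : n + m = 2 * m + 2 by lia.
apply: BS_degree_Some => //; rewrite ?d2 ?nmE //.
  by apply/negP => /p_max; rewrite ltnn.
move=> c; rewrite ltnS => le_cp; apply: dvdz_trans p_dvd.
exact: dvdz_exp2l.
Qed.
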